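(* (1) $\widehat d_{\mathrm B,0}^{\mathrm{Tri}}=\widehat d_{\mathrm B,0}^{\mathrm{Cor}}=\widehat d_{\mathrm B,0}^{\mathrm{Map}}$ (as functions of pairs of finite metric spaces). (2) The pullback bottleneck distance between degree-$0$ verbose barcodes satisfies the triangle inequality: for all finite metric spaces $X,Y,Z$, $\widehat d_{\mathrm B,0}(X,Z)\le\widehat d_{\mathrm B,0}(X,Y)+\widehat d_{\mathrm B,0}(Y,Z)$, where $\widehat d_{\mathrm B,0}=\widehat d_{\mathrm B,0}^{\mathrm{Tri}}$.
   Context: Fix a field $\mathbb{F}$. Finite (pseudo-)metric spaces are nonempty. Vietoris–Rips FCC. For a finite pseudo-metric space $(X,d_X)$, $C_*(\mathrm{VR}(X))$ is the simplicial chain complex over $\mathbb{F}$ of the full simplex on the vertex set $X$ (points at distance $0$ remain distinct vertices), with filtration function $\ell^X(\sum\lambda_i\sigma_i)=\max_{\lambda_i\ne0}\operatorname{diam}(\sigma_i)$ (distinct simplices $\sigma_i$), $\ell^X(0)=-\infty$. Elements $x_1,\dots,x_r$ are orthogonal if $\ell^X(\sum\lambda_ix_i)=\max_{\lambda_i\ne0}\ell^X(x_i)$ for all scalars. Verbose barcode. For $k\ge0$, choose orthogonal ordered bases $(y_1,\dots,y_n)$ of $C_{k+1}$ and $(x_1,\dots,x_m)$ of $\ker\partial_k$ such that, with $r=\operatorname{rank}\partial_{k+1}$, $(y_{r+1},\dots,y_n)$ is a basis of $\ker\partial_{k+1}$, $(x_1,\dots,x_r)$ is a basis of $\operatorname{im}\partial_{k+1}$,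 and $\partial_{k+1}y_i=x_i$ for $i\le r$. The degree-$k$ verbose barcode $\mathcal{B}_{\mathrm{Ver},k}(X)$ is the multiset of pairs $(\ell^X(x_i),\ell^X(y_i))$, $i\le r$, and $(\ell^X(x_i),\infty)$, $r<i\le m$. It does not depend on the choices. Matching distance. $\|(p,q)-(p',q')\|_\infty=\max\{|p-p'|,|q-q'|\}$ if $q,q'<\infty$, $|p-p'|$ if $q=q'=\infty$, $\infty$ otherwise. $d_{\mathrm M}(A,B)=\inf_\phi\sup_{a\in A}\|a-\phi(a)\|_\infty$ over bijections of multisets $\phi:A\to B$ ($\infty$ if cardinalities differ). Pullback bottleneck distances. A finite tripod between $X$ and $Y$ is a finite set $Z$ with surjections $\phi_X:Z\to X$, $\phi_Y:Z\to Y$; $Z_X$ denotes $Z$ with the pseudo-metric $(z,z')\mapsto d_X(\phi_X(z),\phi_X(z'))$, similarly $Z_Y$. Define $\widehat d_{\mathrm B,k}^{\square}(X,Y)=\inf d_{\mathrm M}(\mathcal{B}_{\mathrm{Ver},k}(Z_X),\mathcal{B}_{\mathrm{Ver},k}(Z_Y))$, where the infimum is over: for $\square=\mathrm{Tri}$, all finite tripods; for $\square=\mathrm{Cor}$, tripods given by correspondences $Z=R\subset X\times Y$ (subsets projecting onto both factors) with the two coordinate projections; for $\square=\mathrm{Map}$, correspondences of the form $R=\{(x,f(x)):x\in X\}\cup\{(g(y),y):y\in Y\}$ for arbitrary maps $f:X\to Y$, $g:Y\to X$. *)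

(* Defs.v *)
From HB Require Import structures.
From mathcomp Require Import all_boot all_order all_algebra.
From mathcomp Require Import mathcomp_extra boolp classical_sets reals ereal.

Set Implicit Arguments.
Unset Strict Implicit.
Unset Printing Implicit Defensive.

Import Order.TTheory GRing.Theory Num.Theory.

Local Open Scope classical_set_scope.
Local Open Scope ring_scope.

Record finPseudoMetric (R : realType) := FinPseudoMetric {
  pm_point :> finType;
  pm_nonempty : (0 < #|pm_point|)%N;
  dist : pm_point -> pm_point -> R;
  dist_ge0 : forall x y, 0 <= dist x y;
  distxx : forall x, dist x x = 0;
  dist_sym : forall x y, dist x y = dist y x;
  dist_triangle : forall x y z, dist x z <= dist x y + dist y z }.

Record finMetric (R : realType) := FinMetric {
  fm_pseudo :> finPseudoMetric R;
  dist0_eq : forall x y : fm_pseudo, dist x y = 0 -> x = y }.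

Section VietorisRips.
Variables (R : realType) (F : fieldType) (X : finPseudoMetric R).

(* A k-simplex is a set of k+1 vertices; it is oriented by the enumeration
   order of the finite type X. *)
Definition simplex (k : nat) := {s : {set X} | #|s| == k.+1}.

Definition chain (k : nat) := {ffun simplex k -> F^o}.

Definition diam (s : {set X}) : R :=
  \big[Num.max/0]_(x in s) \big[Num.max/0]_(y in s) dist x y.

(* The coefficient of t in the boundary of the oriented simplex s: the inner
   range contains at most one v, and its sign is given by the position of v
   among the vertices of s. *)
Definition incidence k (s : simplex k.+1) (t : simplex k) : F :=
  \sum_(v in val s | val s :\ v == val t) (-1) ^+ index v (enum (val s)).

Definition boundary_fun k (c : chain k.+1) : chain k :=
  [ffun t => \sum_s c s * incidence s t].

Fact boundary_fun_is_linear k : linear (@boundary_fun k).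
Proof.
move=> a c c'; apply/ffunP => t; rewrite !ffunE [RHS]/=.
rewrite /GRing.scale /= mulr_sumr -big_split /=; apply: eq_bigr => s _.
by rewrite !ffunE mulrDl -mulrA.
Qed.

HB.instance Definition _ k :=
  GRing.isLinear.Build F (chain k.+1) (chain k) *:%R (@boundary_fun k)
    (@boundary_fun_is_linear k).

Definition boundary k : 'Hom(chain k.+1, chain k) := linfun (@boundary_fun k).

(* The kernel of the boundary operator out of degree k; the complex is not
   augmented, so in degree 0 it is the whole space. *)
Definition cycles k : {vspace chain k} :=
  if k is k'.+1 return {vspace chain k} then lker (boundary k') else fullv.

Definition ell k (c : chain k) : \bar R :=
  \big[maxe/-oo%E]_(s | c s != 0) (diam (val s))%:E.

Definition orthogonal_seq k (s : seq (chain k)) : Prop :=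
  forall a : 'I_(size s) -> F,
    ell (\sum_(i < size s) a i *: s`_i) =
    \big[maxe/-oo%E]_(i < size s | a i != 0) ell s`_i.

(* Barcodes are finite multisets, represented by sequences whose order is
   irrelevant. Birth times are levels of basis vectors, which are nonzero, so
   [fine] below is only applied to finite values. *)
Definition is_verbose_barcode k (B : seq (R * \bar R)) : Prop :=
  exists (y : seq (chain k.+1)) (x : seq (chain k)),
    let r := \dim (limg (boundary k)) in
    [/\ basis_of fullv y /\ orthogonal_seq y,
        basis_of (cycles k) x /\ orthogonal_seq x,
        basis_of (lker (boundary k)) (drop r y) /\
          basis_of (limg (boundary k)) (take r x),
        forall i, (i < r)%N -> boundary k y`_i = x`_i
      & B = mkseq (fun i => (fine (ell x`_i),
                             if (i < r)%N then ell y`_i else +oo%E)) (size x)].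

(* The barcode of some choice of bases; such bases always exist, and any two
   choices give the same sequence up to permutation. *)
Definition verbose_barcode k : seq (R * \bar R) :=
  xget [::] [set B | is_verbose_barcode k B].

End VietorisRips.

Section Matching.
Variable R : realType.

Definition bar_dist (a b : R * \bar R) : \bar R :=
  match a.2, b.2 with
  | q%:E, q'%:E => (Num.max `|a.1 - b.1| `|q - q'|)%:E
  | +oo, +oo => (`|a.1 - b.1|)%:E
  | _, _ => +oo
  end%E.

Definition bar0 : R * \bar R := (0, 0%E).

(* Bijections of multisets are bijections of the index sets. The supremum is
   taken in [0, +oo], so that it is 0 for empty barcodes, and the infimum is
   +oo when the sizes differ. *)
Definition matching_dist (A B : seq (R * \bar R)) : \bar R :=
  ereal_inf [set \big[maxe/0%E]_(i < size A)
                   bar_dist (nth bar0 A i) (nth bar0 B (phi i))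
            | phi in [set phi : 'I_(size A) -> 'I_(size B) | bijective phi]].

End Matching.

Definition surjection (T U : Type) (f : T -> U) : Prop :=
  forall u, exists t, f t = u.

Section Pullback.
Variables (R : realType) (X : finPseudoMetric R) (Z : finType) (f : Z -> X).
Hypothesis fS : surjection f.

Fact pullback_nonempty : (0 < #|Z|)%N.
Proof.
have /card_gt0P[x _] := pm_nonempty X.
by have [z _] := fS x; apply/card_gt0P; exists z.
Qed.

Definition pullback : finPseudoMetric R :=
  @FinPseudoMetric R Z pullback_nonempty (fun z z' => dist (f z) (f z'))
    (fun z z' => dist_ge0 (f z) (f z')) (fun z => distxx (f z))
    (fun z z' => dist_sym (f z) (f z'))
    (fun z z' z'' => dist_triangle (f z) (f z') (f z'')).

End Pullback.

Record tripod (X Y : Type) := Tripod {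
  tri_apex : finType;
  tri_left : tri_apex -> X;
  tri_right : tri_apex -> Y;
  tri_leftS : surjection tri_left;
  tri_rightS : surjection tri_right }.

Section Correspondences.
Variables X Y : finType.

Definition correspondence (C : {set X * Y}) : Prop :=
  (forall x, exists y, (x, y) \in C) /\ (forall y, exists x, (x, y) \in C).

Section CorTripod.
Variables (C : {set X * Y}) (CP : correspondence C).

Let lft (p : {p : X * Y | p \in C}) : X := (val p).1.
Let rgt (p : {p : X * Y | p \in C}) : Y := (val p).2.

Fact cor_leftS : surjection lft.
Proof. by move=> x; have [y xy] := CP.1 x; exists (exist _ (x, y) xy). Qed.

Fact cor_rightS : surjection rgt.
Proof. by move=> y; have [x xy] := CP.2 y; exists (exist _ (x, y) xy). Qed.

Definition cor_tripod : tripod X Y := Tripod cor_leftS cor_rightS.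

End CorTripod.

Definition map_cor (f : X -> Y) (g : Y -> X) : {set X * Y} :=
  [set (x, f x) | x in X]%SET :|: [set (g y, y) | y in Y]%SET.

Fact map_corP f g : correspondence (map_cor f g).
Proof.
split=> [x|y]; [exists (f x) | exists (g y)]; rewrite /map_cor inE.
  by rewrite imset_f.
by rewrite [X in _ || X]imset_f ?orbT.
Qed.

End Correspondences.

Section PullbackBottleneck.
Variables (R : realType) (F : fieldType) (k : nat) (X Y : finPseudoMetric R).

Definition tripod_cost (t : tripod X Y) : \bar R :=
  matching_dist (verbose_barcode F (pullback (tri_leftS t)) k)
                (verbose_barcode F (pullback (tri_rightS t)) k).

Definition dB_Tri : \bar R :=
  ereal_inf [set e | exists t : tripod X Y, e = tripod_cost t].

Definition dB_Cor : \bar R :=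
  ereal_inf [set e | exists (C : {set X * Y}) (CP : correspondence C),
                       e = tripod_cost (cor_tripod CP)].

Definition dB_Map : \bar R :=
  ereal_inf [set e | exists (f : X -> Y) (g : Y -> X),
                       e = tripod_cost (cor_tripod (map_corP f g))].

End PullbackBottleneck.

(* Main.v *)
(* Degree-0 bars are all of the form (0, d) with d >= 0, and the number of bars
   with d finite and in a down-set P is the dimension of the space spanned by the boundaries
   of the edges of length in P.  Pulling back along a surjection Z -> X adds
   #|Z| - #|X| to this dimension as soon as 0 is in P, so the barcode of the
   pullback is the barcode of X with #|Z| - #|X| extra bars (0, 0).  Adding one
   bar (0, 0) to both barcodes does not change their matching distance, hence all
   tripods between X and Y have the same cost.  Tripods with common apex
   X * Y * Z then reduce the triangle inequality to that of the matching
   distance. *)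
From HB Require Import structures.
Require Import Defs.
From mathcomp Require Import all_boot all_order all_algebra.
From mathcomp Require Import mathcomp_extra boolp classical_sets reals ereal.
From mathcomp Require Import ring lra.

Set Implicit Arguments.
Unset Strict Implicit.
Unset Printing Implicit Defensive.

Import Order.TTheory GRing.Theory Num.Theory.

Local Open Scope ring_scope.

Lemma size_basis_of (K : fieldType) (V : vectType K) (U : {vspace V}) (s : seq V) :
  basis_of U s -> size s = \dim U.
Proof. by case/andP => /eqP <- /eqP. Qed.

(** * Chains, filtration levels and orthogonal families *)

Section Chains.
Variables (R : realType) (F : fieldType) (X : finPseudoMetric R).

Definition delta k (s : simplex X k) : chain F X k := [ffun t => (t == s)%:R].

Lemma chain_decomp k (c : chain F X k) : c = \sum_s c s *: delta s.
Proof.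
apply/ffunP => t; rewrite sum_ffunE (bigD1 t) //= big1 => [|s st].
  by rewrite !ffunE eqxx addr0 /GRing.scale /= mulr1.
by rewrite !ffunE eq_sym (negPf st) scaler0.
Qed.

Lemma span_delta k : <<[seq delta s | s <- enum predT]>>%VS =
  fullv :> {vspace chain F X k}.
Proof.
apply/vspaceP => c; rewrite memvf.
rewrite [c]chain_decomp memv_suml // => s _.
by rewrite memvZ // memv_span // map_f // mem_enum.
Qed.

Lemma dim_chain k : \dim {:chain F X k} = #|{: simplex X k}|.
Proof. by rewrite dimvf /dim /= muln1. Qed.

Lemma span_delta_supp k (e : seq (simplex X k)) (c : chain F X k) s :
  c \in <<[seq delta t | t <- e]>>%VS -> s \notin e -> c s = 0.
Proof.
set d := map _ _ => cd se.
rewrite (coord_span (X := in_tuple d) cd) sum_ffunE big1 // => i _.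
have ie : (i < size e)%N by rewrite -(size_map (@delta k)) ltn_ord.
rewrite ffunE (nth_map s) // ffunE [s == _]negbTE ?scaler0 //.
by apply: contraNneq se => ->; rewrite mem_nth.
Qed.

Lemma diam_ge0 (A : {set X}) : 0 <= diam A.
Proof. exact: bigmax_ge_id. Qed.

Lemma ell_ge k (c : chain F X k) s : c s != 0 -> ((diam (val s))%:E <= ell c)%E.
Proof. by move=> cs; rewrite /ell (bigD1 s) //= le_max lexx. Qed.

Lemma ell_le k (c : chain F X k) (m : \bar R) :
  (forall s, c s != 0 -> ((diam (val s))%:E <= m)%E) -> (ell c <= m)%E.
Proof. by move=> H; apply: bigmax_le => //; exact: leNye. Qed.

Lemma ell_delta k (s : simplex X k) : ell (delta s) = (diam (val s))%:E.
Proof.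
apply/eqP; rewrite eq_le ell_ge ?ffunE ?eqxx ?oner_eq0 // andbT.
by apply: ell_le => t; rewrite ffunE; have [->|] := eqVneq t s; rewrite ?eqxx.
Qed.

Lemma ell_nz k (c : chain F X k) : c != 0 ->
  exists s, c s != 0 /\ ell c = (diam (val s))%:E.
Proof.
move=> c0; have [s cs] : exists s, c s != 0.
  apply/existsP; apply: contraNT c0; rewrite negb_exists => /forallP H.
  by apply/eqP/ffunP => s; rewrite ffunE; apply/eqP; rewrite -[_ == _]negbK H.
case: (@Order.TotalTheory.arg_maxP _ _ _ s (fun s => c s != 0)
  (fun s => diam (val s)) cs) => t ct H.
exists t; split=> //; apply/eqP; rewrite eq_le ell_ge // andbT.
by apply: ell_le => u cu; rewrite lee_fin; exact: H.
Qed.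

(* Unlike [orthogonal_seq], visibly invariant under permutation. *)
Definition dominated k (s : seq (chain F X k)) :=
  forall (a : chain F X k -> F) v, v \in s -> a v != 0 ->
    (ell v <= ell (\sum_(w <- s) a w *: w)%R)%E.

(** One inequality holds for every family: a simplex in the support of a combination lies in the
    support of one of its terms. Domination is the other inequality. *)
Lemma dominated_orthogonal k (s : seq (chain F X k)) :
  uniq s -> dominated s -> orthogonal_seq s.
Proof.
move=> us ds a; apply/eqP; rewrite eq_le; apply/andP; split.
  apply: ell_le => t; rewrite sum_ffunE => nz.
  have [i ai st] : exists2 i, a i != 0 & s`_i t != 0.
    have : ~~ [forall i, (a i *: s`_i) t == 0].
      by apply: contraNN nz => /forallP H; rewrite big1 // => i _; apply/eqP.
    rewrite negb_forall => /existsP[i]; rewrite ffunE => H; exists i.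
      by apply: contraNneq H => ->; rewrite scale0r.
    by apply: contraNneq H => ->; rewrite scaler0.
  by rewrite (bigD1 i) //= le_max (ell_ge st).
apply: bigmax_le => [|i ai]; first exact: leNye.
(* Coefficients indexed by positions become a function of the vector, which is well defined because
   [s] has no repetitions. *)
pose b v := if insub (index v s) is Some j then a j else 0.
have bE (j : 'I_(size s)) : b s`_j = a j by rewrite /b index_uniq // valK.
rewrite (eq_bigr (fun j : 'I_(size s) => b s`_j *: s`_j)) => [|j _]; last first.
  by rewrite bE.
rewrite -(big_mkord xpredT (fun j => b s`_j *: s`_j)) -(big_nth 0 xpredT (fun w => b w *: w)).
by apply: ds; rewrite ?mem_nth // bE.
Qed.

(* Process the simplices in order of increasing diameter, subtracting from
   [delta s] a combination of shorter ones that has the same image under [f],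
   whenever there is one. The chains so obtained are unitriangular over the
   simplices, so the longest simplex in a combination of them cannot cancel. *)
Lemma triangular_reduction k (W : vectType F) (f : 'Hom(chain F X k, W))
    (e : seq (simplex X k)) :
  uniq e -> sorted (fun s t => diam (val t) <= diam (val s)) e ->
  exists y : seq (chain F X k),
    [/\ size y = size e, <<y>>%VS = <<[seq delta s | s <- e]>>%VS, dominated y
      & free [seq f v | v <- y & f v != 0]].
Proof.
elim: e => [|s e IH] /=; first by exists [::]; split=> //; rewrite /= nil_free.
rewrite path_sortedE => [/andP[se ue] /andP[/allP se' ss]|]; last first.
  by move=> ? ? ? /[swap]; exact: le_trans.
have {IH} [//|//|y [sy spy dy fy]] := IH.
have [z [zs zf]] : exists z, delta s - z \in <<y>>%VS /\
    (f z != 0 -> f z \notin (f @: <<y>>)%VS).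
  have [/memv_imgP[w wy fw]|nf] := boolP (f (delta s) \in (f @: <<y>>)%VS).
    by exists (delta s - w); rewrite subKr linearB /= fw subrr eqxx.
  by exists (delta s); rewrite subrr mem0v.
have zE : z = delta s - (delta s - z) by rewrite subKr.
have ys v : v \in <<y>>%VS -> v s = 0.
  by rewrite spy => /span_delta_supp; apply.
have z1 : z s = 1.
  by move: (ys _ zs); rewrite !ffunE eqxx /= => /eqP; rewrite subr_eq0 => /eqP.
have ell_top v : v \in <<z :: y>>%VS -> (ell v <= (diam (val s))%:E)%E.
  move=> vy; apply: ell_le => t vt; rewrite lee_fin.
  have : v \in <<[seq delta s | s <- s :: e]>>%VS.
    move: v vy {vt}; apply/subvP; rewrite /= !span_cons -spy subv_add addvSr andbT.
    by rewrite -memvE zE memv_add ?memv_line // memvN.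
  move=> vs; have : t \in s :: e by apply: contraNT vt => /(span_delta_supp vs) ->.
  by rewrite inE => /predU1P[->//|/se'].
exists (z :: y); split.
- by rewrite /= sy.
- rewrite /= !span_cons -spy; apply/eqP; rewrite eqEsubv !subv_add !addvSr !andbT.
  rewrite -!memvE; apply/andP; split.
    by rewrite zE memv_add ?memv_line // memvN.
  by rewrite -[delta s](addrNK z) addrC memv_add ?memv_line.
- move=> a v; rewrite big_cons; have [az|az] := eqVneq (a z) 0.
    rewrite az scale0r add0r inE => /predU1P[->|]; first by rewrite az eqxx.
    exact: dy.
  move=> vzy _; apply: le_trans (ell_top _ (memv_span vzy)) (ell_ge _).
  rewrite ffunE (ys (\sum_(w <- y) _)) ?addr0; last first.
    by rewrite big_seq memv_suml // => w wy; rewrite memvZ // memv_span.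
  by rewrite ffunE z1 /GRing.scale /= mulr1.
rewrite /=; case: ifP => // fz; rewrite /= free_cons fy andbT.
apply: contra (zf fz) => fzs.
suff : (<<[seq f v | v <- y & f v != 0%R]>> <= f @: <<y>>)%VS by move/subvP; apply.
apply/span_subvP => _ /mapP[v + ->].
by rewrite mem_filter => /andP[_ vy]; rewrite memv_img ?memv_span.
Qed.

End Chains.

(** * Multisets of bars born at 0 *)

Section DegreeZeroBars.
Variable R : realType.
Implicit Types s t w : seq (R * \bar R).

Definition death_pred (P : pred R) : pred (R * \bar R) :=
  fun b => if b.2 is q%:E then P q else false.

Definition births0 s := forall b, b \in s -> b.1 = 0 /\ (0 <= b.2)%E.

Lemma births0_nseq n s : births0 s -> births0 (nseq n (bar0 R) ++ s).
Proof.
by move=> bs b; rewrite mem_cat mem_nseq => /orP[/andP[_ /eqP->]|/bs].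
Qed.

(** Counts over down-sets recover all multiplicities: that of (0, r) is the count for deaths at most
    r minus the count for deaths below r, and that of (0, +oo) is the size minus the number of
    finite deaths. *)
Lemma perm_births0 s t : births0 s -> births0 t -> size s = size t ->
  (forall P : pred R, (forall u v, u <= v -> P v -> P u) ->
     count (death_pred P) s = count (death_pred P) t) -> perm_eq s t.
Proof.
have fin r w : births0 w -> (count (death_pred (<= r)) w =
    count (death_pred (< r)) w + count_mem (0%R, r%:E) w)%N.
  elim: w => //= -[b0 b] w IH bw; rewrite IH => [|a aw]; last first.
    by apply: bw; rewrite inE aw orbT.
  have [/= -> _] := bw _ (mem_head _ _).
  suff -> : (death_pred (<= r) (0%R, b) =
             death_pred (< r) (0%R, b) + ((0%R : R, b) == (0%R : R, r%:E)) :> nat)%N.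
    by rewrite addnACA.
  rewrite /death_pred xpair_eqE eqxx /=; case: b {bw} => [q| |] //=.
  by rewrite eqe; case: ltgtP.
have inf w : births0 w -> (size w =
    count (death_pred predT) w + count_mem (0%R, +oo%E) w)%N.
  elim: w => //= -[b0 b] w IH bw; rewrite IH => [|a aw]; last first.
    by apply: bw; rewrite inE aw orbT.
  have [/= -> +] := bw _ (mem_head _ _); rewrite xpair_eqE eqxx.
  by rewrite /death_pred; case: b {bw} => [q _| _|] //=; rewrite ?addnS.
move=> bs bt sz cnt.
suff E x : x \in s ++ t -> count_mem x s = count_mem x t.
  by apply/allP => x /E /= ->.
case: x => x0 x xst.
have [/= -> ] : x0 = 0 /\ (0 <= x)%E by move: xst; rewrite mem_cat => /orP[/bs|/bt].
case: x {xst} => [r _|_|//].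
- apply/eqP; rewrite -(eqn_add2l (count (death_pred (< r)) s)) -fin //.
  rewrite !cnt ?fin // => u v uv; [exact: le_lt_trans | exact: le_trans].
- by have := inf s bs; rewrite sz (inf t) // cnt // => /addnI.
Qed.

End DegreeZeroBars.

(** * Existence of the degree-0 barcode and its invariants *)

Section DegreeZero.
Variables (R : realType) (F : fieldType) (X : finPseudoMetric R).

Let bd : 'Hom(chain F X 1, chain F X 0) := boundary F X 0.

Lemma diam_simplex0 (s : simplex X 0) : diam (val s) = 0.
Proof.
by case: s => A /= /cards1P[x ->]; rewrite /diam !big_set1E distxx !maxxx.
Qed.

Lemma card_simplex0 : #|{: simplex X 0}| = #|X|.
Proof. by rewrite card_sig -(bin1 #|X|) -card_draws cardsE. Qed.

Lemma ell_deg0 (c : chain F X 0) : c != 0 -> ell c = 0%E.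
Proof. by move=> /ell_nz[s [_ ->]]; rewrite diam_simplex0. Qed.

(** All nonzero 0-chains have level 0, so it is enough that a combination with a nonzero coefficient
    does not vanish. *)
Lemma free_dominated_deg0 (s : seq (chain F X 0)) : free s -> dominated s.
Proof.
move=> fs a v vs av; rewrite (ell_deg0 (free_not0 fs vs)) ell_deg0 //.
apply: contraNneq av => s0; have [k _ ku] := free_span fs (mem0v _).
by rewrite (ku a) // -(ku (fun=> 0)) // big1 // => i _; rewrite scale0r.
Qed.

(** Triangular reduction of the edges, listed by decreasing diameter because the recursion treats
    the tail first, gives an orthogonal basis. Its vectors split into [g], whose boundaries form a
    basis of the image, and [z], a basis of the kernel. The boundaries are completed by any
    complement, since orthogonality is automatic in degree 0. *)
Lemma verbose_barcode_exists : exists B, is_verbose_barcode F X 0 B.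
Proof.
pose le (s t : simplex X 1) := diam (val t) <= diam (val s).
have [||y [sy spy dy fy]] := triangular_reduction bd (e := sort le (enum predT)).
- by rewrite sort_uniq enum_uniq.
- by apply: sort_sorted => s t; exact: le_total.
have spfull : <<y>>%VS = fullv.
  rewrite spy -span_delta; apply: eq_span => v.
  by apply: perm_mem; rewrite perm_map // perm_sort.
pose g := [seq v <- y | bd v != 0]; pose z := [seq v <- y | bd v == 0].
have pgz : perm_eq (g ++ z) y.
  have -> : z = [seq v <- y | predC (fun v => bd v != 0) v].
    by apply: eq_filter => v /=; rewrite negbK.
  exact/permPl/perm_filterC.
have by_ : basis_of fullv y.
  by rewrite basisEdim spfull subvv /= sy size_sort dim_chain -cardE.
have limE : limg bd = <<[seq bd v | v <- g]>>%VS.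
  rewrite -spfull limg_span; apply/eqP; rewrite eqEsubv; apply/andP.
  split; apply/span_subvP => _ /mapP[v vy ->].
    have [->|nz] := eqVneq (bd v) 0; first exact: mem0v.
    by rewrite memv_span // map_f // mem_filter nz.
  by rewrite memv_span // map_f //; move: vy; rewrite mem_filter => /andP[].
have rE : \dim (limg bd) = size g by rewrite limE (eqP fy) size_map.
have frz : free z by apply: filter_free; exact: basis_free by_.
pose x := [seq bd v | v <- g] ++ vbasis (limg bd)^C.
have bx : basis_of fullv x.
  rewrite -(addv_complf (limg bd)); apply: cat_basis.
  - exact/directv_addP/capv_compl.
  - by rewrite limE; apply/andP; split.
  - exact: vbasisP.
eexists; exists (g ++ z), x => /=; rewrite rE; split; last reflexivity.
- split; first by rewrite (perm_basis _ pgz).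
  apply: dominated_orthogonal.
    by rewrite (perm_uniq pgz) (free_uniq (basis_free by_)).
  move=> a v; rewrite (perm_mem pgz) (perm_big _ pgz); exact: dy.
- split=> //; apply: dominated_orthogonal.
    exact: free_uniq (basis_free bx).
  exact: free_dominated_deg0 (basis_free bx).
- rewrite drop_size_cat // take_size_cat ?size_map //; split.
    rewrite basisEfree frz /=; apply/andP; split.
      apply/span_subvP => v; rewrite mem_filter => /andP[bv _].
      by rewrite memv_ker.
    (* By rank-nullity the free family [z] has as many vectors as the dimension of the kernel. *)
    rewrite -(leq_add2r (size g)) -{1}rE.
    have := limg_ker_dim bd fullv; rewrite capfv => ->.
    rewrite -(size_basis_of by_) -(perm_size pgz) size_cat.
    by rewrite addnC.
  by rewrite limE; apply/andP; split.
- by move=> i ig; rewrite !nth_cat size_map ig (nth_map 0).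
Qed.

(** Since a barcode exists, the default value of [xget] is never taken. *)
Lemma verbose_barcodeP : is_verbose_barcode F X 0 (verbose_barcode F X 0).
Proof.
have [B BP] := verbose_barcode_exists; rewrite /verbose_barcode.
by case: xgetP => [_ -> //|/(_ B)].
Qed.

(** The degree-0 boundaries of the graph on [X] whose edges have length in [P]; the dimension is the
    number of points minus the number of connected components of this graph. *)
Definition sublevel_boundaries (P : pred R) : {vspace chain F X 0} :=
  <<[seq bd (delta F s) | s <- enum predT & P (diam (val s))]>>.

(** The space is spanned by the boundaries of the basis vectors of [y] with index below [r] and
    level in [P]. These boundaries are free, being part of the basis [x], so the dimension counts
    the bars. The right-hand side does not involve the chosen bases. *)
Lemma count_death (P : pred R) B :
    (forall u v, u <= v -> P v -> P u) -> is_verbose_barcode F X 0 B ->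
  count (death_pred P) B = \dim (sublevel_boundaries P).
Proof.
move=> Pdown [y [x]] /=; set r := \dim _ => -[[by_ oy] [bx ox] [bk bi] yx ->].
have sy : (r <= size y)%N.
  by rewrite (size_basis_of by_) -[X in (_ <= X)%N](limg_ker_dim bd) leq_addl.
have sx : (r <= size x)%N by rewrite (size_basis_of bx) dimvS ?subvf.
have bdy i : (r <= i < size y)%N -> bd y`_i = 0.
  move=> /andP[ri iy]; apply/eqP; rewrite -memv_ker -(span_basis bk).
  rewrite -(subnKC ri) -nth_drop memv_span // mem_nth // size_drop.
  by rewrite ltn_sub2r // (leq_ltn_trans ri).
pose Q i := if ell y`_i is q%:E then P q else false.
pose I := [seq i <- iota 0 r | Q i].
have frI : free [seq x`_i | i <- I].
  have frx := basis_free bx.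
  suff /(subseq_uniqP (free_uniq frx)) -> : subseq [seq x`_i | i <- I] x.
    exact: filter_free.
  apply: subseq_trans (take_subseq x r).
  have -> : take r x = [seq x`_i | i <- iota 0 r] by rewrite map_nth_iota0.
  exact/map_subseq/filter_subseq.
have -> : sublevel_boundaries P = <<[seq x`_i | i <- I]>>%VS.
  apply/eqP; rewrite eqEsubv; apply/andP; split; apply/span_subvP => v /mapP[].
    move=> s; rewrite mem_filter => /andP[Ps _] ->.
    (* By orthogonality, the vectors of [y] that occur in the expansion of [delta F s] have level at
       most the diameter of [s], hence in the down-set [P]. *)
    have sE : delta F s \in <<y>>%VS by rewrite (span_basis by_) memvf.
    have {}sE := coord_span (X := in_tuple y) sE.
    set a := coord _ in sE; have := oy (fun i => a i (delta F s)).
    rewrite -sE ell_delta => ellE; rewrite {1}sE linear_sum memv_suml // => i _.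
    rewrite linearZ /=; have [->|ai] := eqVneq (a i (delta F s)) 0.
      by rewrite scale0r mem0v.
    have [ri|ir] := leqP r i; first by rewrite bdy ?ri //= scaler0 mem0v.
    rewrite memvZ // yx // memv_span // map_f //.
    rewrite mem_filter mem_iota /= ir andbT /Q.
    have : (ell y`_i <= (diam (val s))%:E)%E by rewrite ellE le_bigmax_cond.
    have [|t [_ ->]] := @ell_nz _ _ _ _ y`_i.
      by rewrite (free_not0 (basis_free by_)) ?mem_nth.
    by rewrite lee_fin => /Pdown; apply.
  (* Conversely, every edge in the support of a vector of [y] is at most as long as the level of
     that vector. *)
  move=> i; rewrite mem_filter mem_iota add0n => /andP[Qi /= ir] ->.
  rewrite -yx // [y`_i]chain_decomp linear_sum memv_suml // => s _.
  rewrite linearZ /=; have [->|ys] := eqVneq (y`_i s) 0.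
    by rewrite scale0r mem0v.
  rewrite memvZ // memv_span //; apply/mapP; exists s => //.
  rewrite mem_filter mem_enum andbT.
  move: Qi (ell_ge ys); rewrite /Q; case: ell => // q Pq.
  by rewrite lee_fin => /Pdown; apply.
rewrite (eqP frI) size_map size_filter count_map.
(* Bars with index at least [r] are infinite and contribute nothing to the count. *)
rewrite -(subnKC sx) iotaD count_cat add0n [X in (_ + X)%N](@eq_in_count _ _ pred0).
  rewrite count_pred0 addn0; apply: eq_in_count => i.
  by rewrite mem_iota /= /death_pred /= => ->.
by move=> i; rewrite mem_iota /death_pred /= => /andP[ri _]; rewrite ltnNge ri.
Qed.

(** The complex is not augmented, so [x] is a basis of all 0-chains and there is one bar per
    point. *)
Lemma death_barcode B : is_verbose_barcode F X 0 B ->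
  size B = #|X| /\ births0 B.
Proof.
move=> [y [x]] /=; set r := \dim _ => -[[by_ oy] [bx ox] [bk bi] yx ->].
have sy : (r <= size y)%N.
  by rewrite (size_basis_of by_) -[X in (_ <= X)%N](limg_ker_dim bd) leq_addl.
split.
  rewrite size_mkseq (size_basis_of bx) dim_chain.
  exact: card_simplex0.
move=> _ /mapP[i + ->] /=; rewrite mem_iota add0n => /= ix; split.
  by rewrite ell_deg0 // (free_not0 (basis_free bx)) ?mem_nth.
case: ifP => // ir; have [] := @ell_nz _ _ _ _ y`_i.
  by rewrite (free_not0 (basis_free by_)) ?mem_nth ?(leq_trans ir).
by move=> s [_ ->]; rewrite lee_fin diam_ge0.
Qed.

End DegreeZero.

(** * Boundaries of edges as differences of points *)

Section Points.
Variables (R : realType) (F : fieldType) (X : finPseudoMetric R).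

Definition point (x : X) : simplex X 0 := exist _ [set x]%SET (introT eqP (cards1 x)).

Lemma point_bij : bijective point.
Proof.
apply: inj_card_bij => [x y /(congr1 val) /set1_inj//|].
by rewrite card_simplex0.
Qed.

Definition pdelta (x : X) : chain F X 0 := delta F (point x).

Lemma chain_decomp_points (c : chain F X 0) : c = \sum_x c (point x) *: pdelta x.
Proof. by rewrite {1}[c]chain_decomp (reindex point) //; exact/onW_bij/point_bij. Qed.

Lemma diam_set2 (u v : X) : diam [set u; v] = dist u v.
Proof.
apply/eqP; rewrite eq_le; apply/andP; split.
  apply: bigmax_le => [|x]; first exact: dist_ge0.
  rewrite !inE => /orP[] /eqP->; apply: bigmax_le => [|y]; rewrite ?dist_ge0 //;
    by rewrite !inE => /orP[] /eqP-> //; rewrite ?distxx ?dist_ge0 // dist_sym.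
apply: le_trans (le_bigmax_cond _ _ (set21 u v)).
exact: (le_bigmax_cond _ (fun y => dist u y) (set22 u v)).
Qed.

Lemma boundary_edge (u v : X) (s : simplex X 1) : u != v -> val s = [set u; v]%SET ->
  exists b : bool, boundary F X 0 (delta F s) = (-1) ^+ b *: (pdelta u - pdelta v).
Proof.
(* The sign is negative when [u] comes first: removing [u], at index 0, then leaves [v] with
   coefficient 1. *)
move=> uv sE; exists (u == head u (enum (val s))).
rewrite lfunE; apply/ffunP => t; rewrite !ffunE (bigD1 s) //= big1 ?addr0; last first.
  by move=> s' ss'; rewrite ffunE (negPf ss') mul0r.
rewrite ffunE eqxx mul1r /incidence big_mkcondr /=.
have tE w : (t == point w) = ([set w]%SET == val t) by rewrite eq_sym.
have su : val s :\ u = [set v]%SET.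
  by rewrite sE setU1K // inE.
have sv : val s :\ v = [set u]%SET.
  by rewrite sE finset.setUC setU1K // inE eq_sym.
rewrite (eq_bigl (mem [set u; v]%SET)) => [|w]; last by rewrite sE.
rewrite big_setU1 ?inE //= big_set1 su sv !tE.
have : size (enum (val s)) = 2%N by rewrite -cardE; apply/eqP/(valP s).
have : u \in enum (val s) by rewrite mem_enum sE set21.
have : v \in enum (val s) by rewrite mem_enum sE set22.
case: (enum (val s)) => [|a [|b []]] //=; rewrite !inE.
have [au|au] := eqVneq a u; rewrite ?(negPf au) /=.
  case/orP => /eqP vE; first by move: uv; rewrite vE au eqxx.
  move=> _ _; rewrite -vE au (negPf uv) eqxx.
  by do 2 case: ifP => _; rewrite /GRing.scale /=; ring.
move=> + /eqP ub _; rewrite -ub eqxx [v == u]eq_sym (negPf uv) orbF [v == a]eq_sym => ->.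
by do 2 case: ifP => _; rewrite /GRing.scale /=; ring.
Qed.

Lemma pdelta_sub_boundaries (P : pred R) (u v : X) :
  P (dist u v) -> pdelta u - pdelta v \in sublevel_boundaries F X P.
Proof.
have [->|uv] := eqVneq u v; first by rewrite subrr mem0v.
have sP : #|[set u; v]%SET| == 2%N by rewrite cards2 uv.
pose s : simplex X 1 := exist (fun A : {set X} => #|A| == 2) _ sP => Puv.
have [b bE] := boundary_edge (s := s) uv erefl.
rewrite -[_ - _](scalerK (a := (-1) ^+ b)) ?signr_eq0 // memvZ // -bE memv_span //.
by apply/mapP; exists s; rewrite // mem_filter mem_enum andbT diam_set2.
Qed.

Lemma sublevel_boundaries_subv (P : pred R) (U : {vspace chain F X 0}) :
  (forall u v, P (dist u v) -> pdelta u - pdelta v \in U) ->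
  (sublevel_boundaries F X P <= U)%VS.
Proof.
move=> PU; apply/span_subvP => c /mapP[s + ->]; rewrite mem_filter => /andP[Ps _].
have /cards2P[u [v [uv sE]]] := valP s.
have [b ->] := boundary_edge uv sE.
by rewrite memvZ // PU // -diam_set2 -sE.
Qed.

End Points.

(** * Pushforward of 0-chains along a map *)

Section Push.
Variables (R : realType) (F : fieldType) (X Y : finPseudoMetric R) (f : X -> Y).

(** The degree-0 part of the chain map induced by [f]. Edges, which [f] may collapse, are followed
    through differences of points. *)
Definition push_fun (c : chain F X 0) : chain F Y 0 :=
  \sum_x c (point x) *: pdelta F (f x).

Fact push_fun_is_linear : linear push_fun.
Proof.
move=> a c c'; rewrite /push_fun scaler_sumr -big_split /=; apply: eq_bigr => x _.
by rewrite !ffunE scalerDl scalerA.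
Qed.

HB.instance Definition _ :=
  GRing.isLinear.Build F (chain F X 0) (chain F Y 0) *:%R push_fun push_fun_is_linear.

Definition push : 'Hom(chain F X 0, chain F Y 0) := linfun push_fun.

Lemma push_pdelta x : push (pdelta F x) = pdelta F (f x).
Proof.
rewrite lfunE /= /push_fun (bigD1 x) //= big1 ?addr0 => [|x' xx'].
  by rewrite ffunE eqxx scale1r.
rewrite ffunE (inj_eq (bij_inj (point_bij X))) (negPf xx') scale0r //.
Qed.

Lemma push_img : surjection f -> limg push = fullv.
Proof.
move=> fS; apply/vspaceP => c; rewrite memvf [c]chain_decomp_points memv_suml // => y _.
by have [x <-] := fS y; rewrite memvZ // -push_pdelta memv_img ?memvf.
Qed.

End Push.

Lemma card_surjection (T U : finType) (f : T -> U) : surjection f -> (#|U| <= #|T|)%N.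
Proof.
move=> fS; rewrite -(size_codom f) cardE; apply: uniq_leq_size (enum_uniq _) _ => u _.
by have [t <-] := fS u; exact: codom_f.
Qed.

(** * The barcode of a pullback *)

Section IsometricSurjection.
Variables (R : realType) (F : fieldType) (X Z : finPseudoMetric R).
Variables (f : Z -> X) (fS : surjection f).
Hypothesis fd : forall z w, dist z w = dist (f z) (f w).

(** Rank-nullity for [p] restricted to the boundaries of [Z]: they contain the whole kernel of [p],
    and [p] maps them onto the boundaries of [X]. *)
Lemma dim_pullback_boundaries (P : pred R) : P 0 ->
  (\dim (sublevel_boundaries F Z P) =
   (#|Z| - #|X|) + \dim (sublevel_boundaries F X P))%N.
Proof.
move=> P0; pose p := push F f.
have dimk : \dim (lker p) = (#|Z| - #|X|)%N.
  have := limg_ker_dim p fullv; rewrite capfv push_img // !dim_chain !card_simplex0 => <-.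
  by rewrite addnK.
rewrite -(limg_ker_dim p) -dimk; congr (_ + _)%N; congr (\dim _).
  apply/capv_idPr/subvP => c; rewrite memv_ker => /eqP pc.
  (* With a section [g] of [f], a chain killed by [p] is a combination of differences of points [z]
     and [g (f z)]. These are at distance 0, so [P 0] makes the differences boundaries. *)
  have [g gK] := choice fS.
  have c0 : \sum_(z : Z) c (point z) *: pdelta F (g (f z)) = 0.
    apply: (@etrans _ _ (push F g (p c))); last by rewrite pc linear0.
    rewrite [in RHS](chain_decomp_points c) !linear_sum; apply: eq_bigr => z _.
    by rewrite !linearZ /= !push_pdelta.
  have -> : c = \sum_z c (point z) *: (pdelta F z - pdelta F (g (f z))).
    under eq_bigr => z _ do rewrite scalerBr.
    by rewrite sumrB [X in _ - X]c0 subr0; exact: chain_decomp_points.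
  rewrite memv_suml // => z _; rewrite memvZ // pdelta_sub_boundaries //.
  by rewrite fd gK distxx.
apply/eqP; rewrite eqEsubv; apply/andP; split.
  rewrite -[sublevel_boundaries F X P](lpreimK (f := p)) ?push_img ?subvf // limgS //.
  apply: sublevel_boundaries_subv => u v Puv.
  rewrite -memv_preim linearB /= (push_pdelta F f u) (push_pdelta F f v).
  by rewrite pdelta_sub_boundaries // -fd.
apply: sublevel_boundaries_subv => u v.
have [z <-] := fS u; have [w <-] := fS v => Pzw.
by rewrite -!(push_pdelta F f) -linearB memv_img // pdelta_sub_boundaries // fd.
Qed.

Lemma pullback_barcode :
  perm_eq (verbose_barcode F Z 0)
    (nseq (#|Z| - #|X|) (bar0 R) ++ verbose_barcode F X 0).
Proof.
have BZ := verbose_barcodeP F Z; have BX := verbose_barcodeP F X.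
have [sZ bZ] := death_barcode BZ; have [sX bX] := death_barcode BX.
apply: perm_births0 => //.
- exact: births0_nseq.
- by rewrite sZ size_cat size_nseq sX subnK // (card_surjection fS).
move=> P Pdown; rewrite count_cat count_nseq (count_death Pdown BZ) (count_death Pdown BX).
rewrite {1}/death_pred /=; have [P0|P0] := boolP (P 0).
  by rewrite mul1n dim_pullback_boundaries.
(* A down-set without 0 contains no distance at all, so neither space has an admissible edge. *)
suff D0 Y : \dim (sublevel_boundaries F Y P) = 0%N by rewrite !D0.
apply/eqP; rewrite dimv_eq0 -subv0; apply: sublevel_boundaries_subv => u v.
by move=> /(Pdown _ _ (dist_ge0 u v)); rewrite (negPf P0).
Qed.

End IsometricSurjection.

(** * The matching distance through couplings *)

Section Couplings.
Variable R : realType.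
Implicit Types (A B C : seq (R * \bar R)) (r : R).

(** A matching of cost at most [r], written as the list of its matched pairs. Reordering, composing
    and editing such lists is easier than handling bijections of ordinals. *)
Definition coupling r A B := exists L : seq ((R * \bar R) * (R * \bar R)),
  [/\ perm_eq (unzip1 L) A, perm_eq (unzip2 L) B
    & all (fun p => (bar_dist p.1 p.2 <= r%:E)%E) L].

(** Used to reorder a coupling until one of its marginals is a prescribed list. *)
Lemma perm_map_lift (S T : eqType) (f : S -> T) (l : seq S) (t : seq T) :
  perm_eq t (map f l) -> exists2 l', perm_eq l' l & map f l' = t.
Proof.
case: l => [|x0 l]; first by move=> /perm_nilP ->; exists [::].
move=> /(perm_iotaP (f x0))[Is pIs ->].
exists [seq nth x0 (x0 :: l) i | i <- Is].
  by apply/(perm_iotaP x0); exists Is; rewrite ?size_map in pIs *.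
rewrite -map_comp; apply/eq_in_map => i; rewrite (perm_mem pIs) mem_iota size_map.
by move=> /andP[_ il]; rewrite (nth_map x0).
Qed.

Lemma matching_dist_ge0 A B : (0 <= matching_dist A B)%E.
Proof. by apply/ereal_infP => _ [phi _ <-]; exact: bigmax_ge_id. Qed.

(** The infimum ranges over finitely many bijections, so when one exists it is attained, and an
    optimal bijection gives the coupling. *)
Lemma matching_dist_le r A B : 0 <= r ->
  (matching_dist A B <= r%:E)%E <-> coupling r A B.
Proof.
move=> r0; split=> [|[L [LA LB Lr]]].
  (* Without a bijection the infimum is that of the empty set, +oo, which no real bounds. *)
  have [[phi0 bphi0]|no] :=
    pselect (exists phi : 'I_(size A) -> 'I_(size B), bijective phi); last first.
    rewrite /matching_dist (_ : [set phi | _]%classic = set0) ?image_set0 ?ereal_inf0 //.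
    by apply/seteqP; split=> // phi bphi; case: no; exists phi.
  pose cost (phi : 'I_(size A) -> 'I_(size B)) :=
    \big[maxe/0%E]_(i < size A) bar_dist (nth (bar0 R) A i) (nth (bar0 R) B (phi i)).
  have ffunb (phi : 'I_(size A) -> 'I_(size B)) : 
      bijective phi -> `[< bijective [ffun i => phi i] >].
    by move=> bphi; apply/asboolP/(eq_bij bphi) => i; rewrite ffunE.
  case: (@Order.TotalTheory.arg_minP _ _ _ [ffun i => phi0 i]
    (fun phi : {ffun _} => `[< bijective phi >]) (fun phi => cost phi) (ffunb _ bphi0)).
  move=> phi /asboolP bphi phimin le_r.
  have cphi : (cost phi <= r%:E)%E.
    apply: le_trans le_r; apply/ereal_infP => _ [psi bpsi <-].
    apply: le_trans (phimin _ (ffunb _ bpsi)) _.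
    by rewrite le_eqVlt; apply/orP; left; apply/eqP/eq_bigr => i _; rewrite ffunE.
  pose L := [seq (nth (bar0 R) A i, nth (bar0 R) B (phi i))
              | i : 'I_(size A) <- enum 'I_(size A)].
  exists L; split.
  - have -> : unzip1 L =
        [seq nth (bar0 R) A i | i <- map val (enum 'I_(size A))].
      by rewrite /unzip1 /L -!map_comp.
    by rewrite val_enum_ord map_nth_iota0 // take_size.
  - have -> : unzip2 L =
        [seq nth (bar0 R) B i | i <- map val (map phi (enum 'I_(size A)))].
      by rewrite /unzip2 /L -!map_comp.
    rewrite -[X in perm_eq _ X](take_size B) -(map_nth_iota0 (bar0 R)) //.
    rewrite -val_enum_ord !perm_map //.
    apply: uniq_perm; rewrite ?(map_inj_uniq (bij_inj bphi)) ?enum_uniq //.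
    move=> j; rewrite mem_enum; apply/mapP; have [psi _ psiK] := bphi.
    by exists (psi j); rewrite ?mem_enum ?psiK.
  - apply/allP => _ /mapP[i _ ->] /=; apply: le_trans cphi.
    exact: (le_bigmax _ (fun i : 'I_(size A) => _)).
(* Once the first components spell [A], the second ones are a permutation of [B]; the list [Is] of
   their positions in [B] is the bijection. *)
have [L' LL' LA'] : exists2 L', perm_eq L' L & unzip1 L' = A.
  by apply: perm_map_lift; rewrite perm_sym.
have {}LB : perm_eq (unzip2 L') B by rewrite (perm_trans _ LB) // perm_map.
have {}Lr : all (fun p => (bar_dist p.1 p.2 <= r%:E)%E) L' by rewrite (perm_all _ LL').
have sA : size L' = size A by rewrite -LA' size_map.
have [Is pIs IsE] := perm_iotaP (bar0 R) LB.
have uIs : uniq Is by rewrite (perm_uniq pIs) iota_uniq.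
have sIs : size Is = size A by rewrite -sA -(size_map snd L') -/(unzip2 L') IsE size_map.
have phiP (i : 'I_(size A)) : (nth 0 Is i < size B)%N.
  have : nth 0%N Is i \in Is by rewrite mem_nth // sIs.
  by rewrite (perm_mem pIs) mem_iota.
apply: (@le_trans _ _ (\big[maxe/0%E]_(i < size A)
    bar_dist (nth (bar0 R) A i) (nth (bar0 R) B (Ordinal (phiP i))))).
  apply: ereal_inf_lbound; exists (fun i => Ordinal (phiP i)) => //.
  apply: inj_card_bij => [i j /(congr1 val) /= /eqP|].
    by rewrite nth_uniq ?sIs // => /eqP/val_inj.
  by rewrite !card_ord -sIs (perm_size pIs) size_iota.
apply: bigmax_le => [|i _ /=]; first by rewrite lee_fin.
have : (i < size L')%N by rewrite sA.
move: (nat_of_ord i) => k kL; have := all_nthP (bar0 R, bar0 R) Lr k kL.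
rewrite -LA' (nth_map (bar0 R, bar0 R)) //.
rewrite -(nth_map 0%N (bar0 R) (nth (bar0 R) B)) ?sIs -?sA // -IsE.
by rewrite (nth_map (bar0 R, bar0 R)).
Qed.

Lemma coupling_perm r A A' B B' : perm_eq A A' -> perm_eq B B' ->
  coupling r A B -> coupling r A' B'.
Proof.
by move=> pA pB [L [LA LB Lr]]; exists L; rewrite (perm_trans LA) // (perm_trans LB).
Qed.

(** Reorder the second coupling so that its copy of [B] agrees with that of the first, then zip the
    outer marginals; the bound is the triangle inequality for each triple of bars. *)
Lemma coupling_trans r s A B C :
  coupling r A B -> coupling s B C -> coupling (r + s) A C.
Proof.
move=> [L [LA LB Lr]] [M [MB MC Ms]].
have [M' M'M M'E] : exists2 M', perm_eq M' M & unzip1 M' = unzip2 L.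
  by apply: perm_map_lift; rewrite (perm_trans LB) // perm_sym.
have sz : size L = size M' by have := congr1 size M'E; rewrite !size_map.
exists (zip (unzip1 L) (unzip2 M')); split.
- by rewrite unzip1_zip // !size_map sz.
- rewrite unzip2_zip ?size_map ?sz //.
  by rewrite (perm_trans _ MC) // perm_map.
apply/(all_nthP (bar0 R, bar0 R)) => i; rewrite size_zip !size_map -sz minnn => iL.
rewrite nth_zip ?size_map //=.
have {}Ms : all (fun p => (bar_dist p.1 p.2 <= s%:E)%E) M' by rewrite (perm_all _ M'M).
have := all_nthP (bar0 R, bar0 R) Lr i iL.
have := all_nthP (bar0 R, bar0 R) Ms i; rewrite -sz => /(_ iL).
have -> : (nth (bar0 R, bar0 R) M' i).1 = nth (bar0 R) (unzip1 M') i.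
  by rewrite (nth_map (bar0 R, bar0 R)) -?sz.
rewrite M'E !(nth_map (bar0 R, bar0 R)) -?sz //.
move: (nth _ L i) (nth _ M' i) => [[a1 a2] [b1 b2]] [_ [c1 c2]] /=.
rewrite /bar_dist /=; case: a2 b2 c2 => [a2| |] [b2| |] [c2| |] //=; rewrite !lee_fin.
  rewrite !ge_max => /andP[bc1 bc2] /andP[ab1 ab2]; apply/andP; split.
    by apply: le_trans (lerD ab1 bc1); exact: ler_distD.
  by apply: le_trans (lerD ab2 bc2); exact: ler_distD.
by move=> bc ab; apply: le_trans (lerD ab bc); exact: ler_distD.
Qed.

(* If the two trivial bars are matched to [b] and [a], then [a] and [b] can be
   matched instead: deaths are nonnegative, so [|a - b| <= max a b]. *)
Lemma coupling_cons_bar0 r A B : 0 <= r -> births0 A -> births0 B ->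
  coupling r (bar0 R :: A) (bar0 R :: B) <-> coupling r A B.
Proof.
move=> r0 bA bB; split; last first.
  move=> [L [LA LB Lr]]; exists ((bar0 R, bar0 R) :: L); rewrite /= !perm_cons.
  by split=> //; rewrite Lr andbT /bar_dist /= !subrr normr0 maxxx lee_fin.
move=> [L [LA LB Lr]].
have /mapP[[z b] zL /= zE] : bar0 R \in unzip1 L by rewrite (perm_mem LA) mem_head.
subst z; have pL := perm_to_rem zL; set L1 := rem _ _ in pL.
have {}LA : perm_eq (unzip1 L1) A.
  rewrite -(perm_cons (bar0 R)) -(permPr LA) perm_sym; exact: (perm_map fst pL).
have {}LB : perm_eq (b :: unzip2 L1) (bar0 R :: B).
  rewrite -(permPr LB) perm_sym; exact: (perm_map snd pL).
move: Lr; rewrite (perm_all _ pL) /= => /andP[br Lr].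
have [b0|bn0] := eqVneq b (bar0 R).
  by exists L1; split=> //; rewrite -(perm_cons (bar0 R)) -{1}b0.
have /mapP[[a z] aL /= zE] : bar0 R \in unzip2 L1.
  have := perm_mem LB (bar0 R); rewrite !inE eqxx /= => /orP[/eqP zb|//].
  by rewrite zb eqxx in bn0.
subst z; have pL1 := perm_to_rem aL; set L2 := rem _ _ in pL1.
have aA : a \in A by rewrite -(perm_mem LA); apply/mapP; exists (a, bar0 R).
have bB' : b \in B.
  by have := perm_mem LB b; rewrite mem_head inE (negPf bn0) => /= <-.
move: Lr; rewrite (perm_all _ pL1) /= => /andP[ar Lr].
exists ((a, b) :: L2); split.
- rewrite -(permPr LA) perm_sym; exact: (perm_map fst pL1).
- rewrite -(perm_cons (bar0 R)); apply: perm_trans LB.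
  apply: perm_trans (_ : perm_eq _ (b :: bar0 R :: unzip2 L2)) _.
    exact: (permEl (perm_catCA [:: bar0 R] [:: b] _)).
  by rewrite perm_cons perm_sym; exact: (perm_map snd pL1).
rewrite /= Lr andbT; have [a1 a2] := bA _ aA; have [b1 b2] := bB _ bB'.
move: a1 a2 b1 b2 ar br; rewrite /bar_dist; case: (a) (b) => [x p] [y q] /= -> + ->.
case: p q => [p| |] [q| |] //=; rewrite !lee_fin !subr0 !sub0r !normr0 !normrN.
move=> p0 q0; rewrite !ge_max r0 /= (ger0_norm p0) (ger0_norm q0) => pr qr.
by rewrite ler_norml; apply/andP; split; lra.
Qed.

Lemma coupling_nseq_bar0 n r A B : 0 <= r -> births0 A -> births0 B ->
  coupling r (nseq n (bar0 R) ++ A) (nseq n (bar0 R) ++ B) <-> coupling r A B.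
Proof.
move=> r0 bA bB; elim: n => //= n IH.
by rewrite coupling_cons_bar0 //; exact: births0_nseq.
Qed.

(** Both distances lie in [0, +oo], where a value is determined by the nonnegative reals above
    it. *)
Lemma eq_matching_dist A B A' B' :
  (forall r, 0 <= r -> coupling r A B <-> coupling r A' B') ->
  matching_dist A B = matching_dist A' B'.
Proof.
move=> H; have {}H r : 0 <= r ->
    (matching_dist A B <= r%:E)%E <-> (matching_dist A' B' <= r%:E)%E.
  by move=> r0; rewrite !matching_dist_le // H.
have := matching_dist_ge0 A B; have := matching_dist_ge0 A' B'.
case: (matching_dist A B) (matching_dist A' B') H => [p| |] [q| |] //= H.
- rewrite !lee_fin => q0 p0; have [/(_ (lexx _)) qp _] := H p p0.
  by have [_ /(_ (lexx _)) pq] := H q q0; apply: le_anti; rewrite pq.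
- by rewrite lee_fin => _ p0; have [/(_ (lexx _))] := H p p0.
- by rewrite lee_fin => p0 _; have [_ /(_ (lexx _))] := H q p0.
Qed.

Lemma matching_dist_triangle A B C :
  (matching_dist A C <= matching_dist A B + matching_dist B C)%E.
Proof.
have := matching_dist_ge0 A B; have := matching_dist_ge0 B C.
case ABE : (matching_dist A B) => [p| |]; case BCE : (matching_dist B C) => [q| |] //=;
  rewrite ?leey // !lee_fin => q0 p0.
rewrite -EFinD matching_dist_le ?addr_ge0 //.
by apply: (coupling_trans (B := B)); apply/matching_dist_le; rewrite // (ABE, BCE).
Qed.

End Couplings.

(** * Independence of the tripod and the two claims *)

Section Tripods.
Variables (R : realType) (F : fieldType).
Implicit Types X Y Z : finPseudoMetric R.

(** Up to order, the two barcodes depend only on the size of the apex, and [n] further points add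
    [n] bars (0, 0) to both, which cancel. *)
Lemma tripod_cost_indep X Y (t t' : tripod X Y) : tripod_cost F 0 t = tripod_cost F 0 t'.
Proof.
wlog tt' : t t' / (#|tri_apex t| <= #|tri_apex t'|)%N.
  by move=> H; case/orP: (leq_total #|tri_apex t| #|tri_apex t'|) => /H.
have bX := (death_barcode (verbose_barcodeP F X)).2.
have bY := (death_barcode (verbose_barcodeP F Y)).2.
have pb (Z : finPseudoMetric R) (T : finType) (f : T -> Z) (fS : surjection f) :
    perm_eq (verbose_barcode F (pullback fS) 0)
            (nseq (#|T| - #|Z|) (bar0 R) ++ verbose_barcode F Z 0).
  exact: (@pullback_barcode _ F Z (pullback fS) f).
have cX := card_surjection (tri_leftS t); have cY := card_surjection (tri_rightS t).
pose n := (#|tri_apex t'| - #|tri_apex t|)%N.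
apply: eq_matching_dist => r r0.
have pt (s : tripod X Y) : coupling r (verbose_barcode F (pullback (tri_leftS s)) 0)
      (verbose_barcode F (pullback (tri_rightS s)) 0) <->
    coupling r (nseq (#|tri_apex s| - #|X|) (bar0 R) ++ verbose_barcode F X 0)
      (nseq (#|tri_apex s| - #|Y|) (bar0 R) ++ verbose_barcode F Y 0).
  by split; apply: coupling_perm; rewrite // perm_sym.
have nE (Z : finPseudoMetric R) : (#|Z| <= #|tri_apex t|)%N ->
    (n + (#|tri_apex t| - #|Z|) = #|tri_apex t'| - #|Z|)%N.
  by move=> cZ; rewrite addnBA // subnK.
apply: (iff_trans (pt t)); apply: (iff_sym (iff_trans (pt t') _)).
rewrite -(nE X cX) -(nE Y cY) !nseqD -!catA.
by apply: coupling_nseq_bar0 => //; exact: births0_nseq.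
Qed.

(** All costs being equal, [S] is a singleton; this treats the three kinds of tripods at once. *)
Lemma inf_tripod_costs X Y (t0 : tripod X Y) (S : set \bar R) :
  S (tripod_cost F 0 t0) ->
  (forall e, S e -> exists t : tripod X Y, e = tripod_cost F 0 t) ->
  ereal_inf S = tripod_cost F 0 t0.
Proof.
move=> St0 H; rewrite (_ : S = [set tripod_cost F 0 t0]%classic) ?ereal_inf1 //.
by apply/seteqP; split=> [e /H[t ->]|_ ->//]; exact: tripod_cost_indep.
Qed.

Lemma dB_Tri_cost X Y (t : tripod X Y) : dB_Tri F 0 X Y = tripod_cost F 0 t.
Proof. by apply: inf_tripod_costs => //; exists t. Qed.

Lemma pm_inhabited X : inhabited X.
Proof. by have /card_gt0P[x _] := pm_nonempty X. Qed.

End Tripods.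

Theorem corollary6p10 (R : realType) (F : fieldType) :
  (forall X Y : finMetric R,
      dB_Tri F 0 X Y = dB_Cor F 0 X Y /\ dB_Cor F 0 X Y = dB_Map F 0 X Y) /\
  (forall X Y Z : finMetric R,
      (dB_Tri F 0 X Z <= dB_Tri F 0 X Y + dB_Tri F 0 Y Z)%E).
Proof.
split=> [X Y|X Y Z].
  have [x0] := pm_inhabited X; have [y0] := pm_inhabited Y.
  (* Any maps would do; constant ones exist because the spaces are nonempty. *)
  pose f : X -> Y := fun=> y0; pose g : Y -> X := fun=> x0.
  pose t := cor_tripod (map_corP f g).
  rewrite (dB_Tri_cost F t).
  have -> : dB_Cor F 0 X Y = tripod_cost F 0 t.
    apply: inf_tripod_costs => [|e [C [CP ->]]]; last by eexists.
    by exists (map_cor f g), (map_corP f g).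
  have -> // : dB_Map F 0 X Y = tripod_cost F 0 t.
  apply: inf_tripod_costs => [|e [f' [g' ->]]]; last by eexists.
  by exists f, g.
have [x0] := pm_inhabited X; have [y0] := pm_inhabited Y.
have [z0] := pm_inhabited Z.
pose pX (p : X * Y * Z) := p.1.1; pose pY (p : X * Y * Z) := p.1.2.
pose pZ (p : X * Y * Z) := p.2.
have sX : surjection pX by move=> x; exists (x, y0, z0).
have sY : surjection pY by move=> y; exists (x0, y, z0).
have sZ : surjection pZ by move=> z; exists (x0, y0, z).
(* The three costs are now matching distances between the same three pullback barcodes. *)
rewrite (dB_Tri_cost F (Tripod sX sZ)) (dB_Tri_cost F (Tripod sX sY)).
rewrite (dB_Tri_cost F (Tripod sY sZ)).
exact: matching_dist_triangle.
Qed.
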